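(* If $I$ is a $\beta$-acyclic instance of $\#\mathrm{CSP}_{\mathrm{def}}$ on a finite domain $D$, then $w(I)$ can be computed with $O(s(I)^2\,\|I\|)$ arithmetic operations, where $s(I)=\sum_{c\in I}|\mathrm{var}(c)|$.
   Context: A weighted constraint with default value $c$ on a finite variable set $\mathrm{var}(c)=X$ and domain $D$ is a pair $(f,\delta)$ with $f:S\to\mathbb{Q}_{\ge 0}$, $S\subseteq D^X$ (the support), $\delta\in\mathbb{Q}_{\ge0}$; it induces the total function $c(a)=f(a)$ for $a\in S$, $c(a)=\delta$ otherwise; $|c|=|S|\cdot|X|$. An instance $I$ is a finite set of such constraints on a common domain; $\mathrm{var}(I)=\bigcup_c\mathrm{var}(c)$, $\|I\|=\sum_c|c|$, $w(I)=\sum_{a\in D^{\mathrm{var}(I)}}\prod_{c\in I}c(a|_{\mathrm{var}(c)})$. $\mathcal H(I)=(\mathrm{var}(I),\{\mathrm{var}(c)\mid c\in I\})$. For a hypergraph $\mathcal H$, $\mathcal H\setminus x$ has vertices $V(\mathcal H)\setminus\{x\}$ and edges $\{e\setminus\{x\}\mid e\in E(\mathcal H)\}\setminus\{\emptyset\}$. A nest point is a vertex whose containing edges are totally ordered by inclusion. A $\beta$-elimination order is a sequence $(x_1,\dots,x_n)$ of all vertices with $x_1$ a nest point of $\mathcal H$ and $(x_2,\dots,x_n)$ a $\beta$-elimination order of $\mathcal H\setminus x_1$; $I$ is $\beta$-acyclic if $\mathcal H(I)$ has one.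
   Formalization: The bound proved is O(s(I)²‖I‖ + m + 1), m the number of constraints, since O(s(I)²‖I‖) fails e.g. when all supports are empty (‖I‖ = 0); operations are counted as the length of a weight-independent straight-line program with x/0 = 0. *)

(* Defs.v *)
From HB Require Import structures.
From mathcomp Require Import all_boot all_order all_algebra.
Set Implicit Arguments. Unset Strict Implicit. Unset Printing Implicit Defensive.
Import Order.TTheory GRing.Theory Num.Theory.
Local Open Scope ring_scope.

Section Defs.
Variables (D V : finType).

Definition asg (X : {set V}) := {ffun {x : V | x \in X} -> D}.

Definition restr (Y X : {set V}) (h : X \subset Y) (a : asg Y) : asg X :=
  [ffun x => a (Sub (val x) (subsetP h _ (valP x)))].

(* An instance with m constraints: scopes sc i = var(c_i), supports supp i,
   support values fv i, default values dv i. The "structure" (m, sc, supp) is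
   separated from the weights (fv, dv). *)

Definition varI (m : nat) (sc : 'I_m -> {set V}) : {set V} := \bigcup_(i < m) sc i.

Lemma sc_sub_var (m : nat) (sc : 'I_m -> {set V}) (i : 'I_m) : sc i \subset varI sc.
Proof. by apply: (bigcup_sup i). Qed.

Definition cval (X : {set V}) (S : {set asg X}) (f : asg X -> rat) (d : rat)
  (a : asg X) : rat := if a \in S then f a else d.

Definition wI (m : nat) (sc : 'I_m -> {set V}) (supp : forall i, {set asg (sc i)})
  (fv : forall i, asg (sc i) -> rat) (dv : 'I_m -> rat) : rat :=
  \sum_(a : asg (varI sc))
     \prod_(i < m) cval (supp i) (fv i) (dv i) (restr (sc_sub_var sc i) a).

Definition normI (m : nat) (sc : 'I_m -> {set V}) (supp : forall i, {set asg (sc i)}) : nat :=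
  (\sum_(i < m) #|supp i| * #|sc i|)%N.

Definition sI (m : nat) (sc : 'I_m -> {set V}) : nat := (\sum_(i < m) #|sc i|)%N.

Record hgraph := HGraph { hV : {set V}; hE : {set {set V}} }.

Definition HI (m : nat) (sc : 'I_m -> {set V}) : hgraph :=
  HGraph (varI sc) [set sc i | i : 'I_m].

Definition hremove (H : hgraph) (x : V) : hgraph :=
  HGraph (hV H :\ x) ([set e :\ x | e in hE H] :\ set0).

Definition nest_point (H : hgraph) (x : V) : Prop :=
  x \in hV H /\
  forall e1 e2, e1 \in hE H -> e2 \in hE H -> x \in e1 -> x \in e2 ->
    e1 \subset e2 \/ e2 \subset e1.

Inductive beta_elim : hgraph -> seq V -> Prop :=
| beta_elim_nil H : hV H = set0 -> beta_elim H [::]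
| beta_elim_cons H x s :
    nest_point H x -> beta_elim (hremove H x) s -> beta_elim H (x :: s).

Definition beta_acyclic (H : hgraph) : Prop := exists s, beta_elim H s.

(* Algebraic model of computation: straight-line programs over Q whose shape
   may depend on the structure (scopes, supports) of the instance but not on
   the weights. Instructions refer to earlier results by index. *)
Inductive instr (m : nat) (sc : 'I_m -> {set V}) :=
| IWeight (i : 'I_m) (a : asg (sc i))
| IDefault (i : 'I_m)
| IConst (q : rat)
| IAdd (j k : nat)
| ISub (j k : nat)
| IMul (j k : nat)
| IDiv (j k : nat).

Definition eval_instr (m : nat) (sc : 'I_m -> {set V})
  (fv : forall i, asg (sc i) -> rat) (dv : 'I_m -> rat)
  (vals : seq rat) (ins : instr sc) : rat :=
  match ins with
  | IWeight i a => fv i a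
  | IDefault i => dv i
  | IConst q => q
  | IAdd j k => nth 0 vals j + nth 0 vals k
  | ISub j k => nth 0 vals j - nth 0 vals k
  | IMul j k => nth 0 vals j * nth 0 vals k
  | IDiv j k => nth 0 vals j / nth 0 vals k
  end.

Definition exec (m : nat) (sc : 'I_m -> {set V})
  (fv : forall i, asg (sc i) -> rat) (dv : 'I_m -> rat) (P : seq (instr sc)) : seq rat :=
  foldl (fun vals ins => rcons vals (eval_instr fv dv vals ins)) [::] P.

Definition output (m : nat) (sc : 'I_m -> {set V})
  (fv : forall i, asg (sc i) -> rat) (dv : 'I_m -> rat) (P : seq (instr sc)) : rat :=
  last 0 (exec fv dv P).

End Defs.

(* Main.v *)
Require Import Defs.
From HB Require Import structures.
From mathcomp Require Import all_boot all_order all_algebra.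
From mathcomp Require Import zify.
Set Implicit Arguments. Unset Strict Implicit. Unset Printing Implicit Defensive.
Import Order.TTheory GRing.Theory Num.Theory.
Local Open Scope ring_scope.

(** Eliminate the variables along a beta-elimination order. The constraints
    [c_1, ..., c_k] containing a nest point [x] have nested scopes. With
    [P_j A] the sum over [d] of [c_1 ... c_j] at [A] with [x := d], so that [P_0 = #|D|],
    replace [c_j] by [P_j / P_(j-1)]: the product telescopes to [P_k / #|D|], and
    nonnegativity makes [P_j] vanish with [P_(j-1)], which agrees with [0 / 0 = 0].
    Off the projection of its support [c_j] is constantly its default [dl_j], where
    [P_j = dl_j P_(j-1)]; so supports are merely projected and defaults never change.
    On the projection,
    [P_j = dl_j P_(j-1) + \sum (c_j - dl_j) c_1 ... c_(j-1)], the sum ranging over the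
    support elements above the given point, so each support element costs [O(k)]
    operations. Summed over all variables this is [O(s(I) ||I||)]. The factors [#|D|]
    are absorbed into one final constant. *)

(** * Partial assignments as masked total functions *)

Section Masking.
Variables (D V : finType) (d0 : D).
Implicit Types (X Y : {set V}) (A B : {ffun V -> D}).

(** A partial assignment on [X] is encoded as a total one equal to [d0] off [X], so that scopes can
    shrink without a change of type. *)
Definition mask_on X A : {ffun V -> D} :=
  [ffun v => if v \in X then A v else d0].

Definition update A x d : {ffun V -> D} := [ffun v => if v == x then d else A v].

Lemma mask_on_sub X Y A : X \subset Y -> mask_on X (mask_on Y A) = mask_on X A.
Proof.
move=> /subsetP sXY; apply/ffunP => v; rewrite !ffunE.
by case: ifP => // /sXY ->.
Qed.

Lemma mask_on_update X A x d : x \notin X -> mask_on X (update A x d) = mask_on X A.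
Proof.
move=> xX; apply/ffunP => v; rewrite !ffunE.
by case: ifP => // vX; case: eqP => // vx; rewrite -vx vX in xX.
Qed.

Lemma mask_on_updateD1 X A x d :
  mask_on (X :\ x) (update A x d) = mask_on (X :\ x) A.
Proof. by rewrite mask_on_update // !inE eqxx. Qed.

Lemma update_mask_on X A x d : x \in X ->
  mask_on X (update A x d) = update (mask_on (X :\ x) A) x d.
Proof.
move=> xX; apply/ffunP => v; rewrite !ffunE !inE.
by case: eqVneq => [->|] //=; rewrite xX.
Qed.

Lemma update_mask_on_id X A x : x \in X ->
  update (mask_on (X :\ x) A) x (A x) = mask_on X A.
Proof.
move=> xX; apply/ffunP => v; rewrite !ffunE !inE.
by case: eqVneq => [->|] //=; rewrite xX.
Qed.

Lemma mask_on_update_mask X Y A x d : X \subset Y ->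
  mask_on X (update (mask_on (Y :\ x) A) x d) = mask_on X (update A x d).
Proof.
move=> /subsetP sXY; apply/ffunP => v; rewrite !ffunE !inE.
by case: ifP => // /sXY ->; case: eqP.
Qed.

(* The involution (A, d) |-> (A[x := d], A x) exchanges the two summands. *)
Lemma sum_update (R : pzRingType) x (F : {ffun V -> D} -> R) :
  \sum_A \sum_d F (update A x d) = #|D|%:R * \sum_A F A.
Proof.
pose swap (p : {ffun V -> D} * D) := (update p.1 x p.2, p.1 x).
have swapK : involutive swap.
  case=> A d; rewrite /swap /=; congr pair; last by rewrite ffunE eqxx.
  by apply/ffunP => v; rewrite !ffunE; case: eqP => // ->.
rewrite pair_bigA /= (eq_bigr (fun p => F (swap p).1)) //.
rewrite -(reindex_inj (inv_inj swapK) (P := predT) (F := fun p => F p.1)) /=.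
rewrite -(pair_bigA _ (fun A d => F A)) /= big_distrr /=.
by apply: eq_bigr => A _; rewrite sumr_const mulr_natl; congr (_ *+ _).
Qed.

End Masking.

(** * Elimination of one nest point *)

Section Elimination.
Variables (R : realFieldType) (D V I : finType) (d0 : D).
Notation T := {ffun V -> D}.
Notation mask_on := (mask_on d0).

Definition keyed_value (X : I -> {set V}) (S : I -> {set T}) (c : I -> T -> R)
    (dl : I -> R) (i : I) (A : T) : R :=
  if mask_on (X i) A \in S i then c i (mask_on (X i) A) else dl i.

Variables (X : I -> {set V}) (S : I -> {set T}) (c : I -> T -> R) (dl : I -> R).
Variables (x : V) (L : seq I).

Notation cv := (keyed_value X S c dl).

Definition elim_scope i := X i :\ x.
Definition elim_supp i := mask_on (elim_scope i) @: S i.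
(** For [s] the first [j] entries of [L], this is [P_j]. *)
Definition marginal (s : seq I) (A : T) : R :=
  \sum_d \prod_(j <- s) cv j (update A x d).
Definition before i := take (index i L) L.
Definition elim_value i (B : T) : R :=
  if i \in L then marginal (rcons (before i) i) B / marginal (before i) B
  else c i B.

Notation cv' := (keyed_value elim_scope elim_supp elim_value dl).

Hypothesis mem_L : forall i, (i \in L) = (x \in X i).
Hypothesis uniq_L : uniq L.
Hypothesis chain_L : forall pre i post, L = pre ++ i :: post ->
  forall j, j \in pre -> X j \subset X i.
Hypothesis S_masked : forall i B, B \in S i -> mask_on (X i) B = B.
Hypothesis c_ge0 : forall i B, B \in S i -> 0 <= c i B.
Hypothesis dl_ge0 : forall i, 0 <= dl i.

Lemma before_split pre i post : L = pre ++ i :: post -> before i = pre.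
Proof.
move=> eL; have := uniq_L; rewrite /before eL cat_uniq => /and3P [_ /hasPn h _].
rewrite index_cat; case: ifP => [ipre|_].
  by have := h i (mem_head i post); rewrite /= ipre.
by rewrite /= eqxx addn0 take_size_cat.
Qed.

Lemma keyed_value_ge0 i A : 0 <= cv i A.
Proof. by rewrite /keyed_value; case: ifP => [/c_ge0|]. Qed.

Lemma marginal_ge0 s A : 0 <= marginal s A.
Proof.
by apply: sumr_ge0 => d _; apply: prodr_ge0 => j _; apply: keyed_value_ge0.
Qed.

Lemma elim_value_ge0 i B : B \in elim_supp i -> 0 <= elim_value i B.
Proof.
rewrite /elim_value; case: ifP => [_ _|iL]; first by rewrite divr_ge0 ?marginal_ge0.
case/imsetP => A AS ->; rewrite /elim_scope.
have -> : X i :\ x = X i.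
  by apply/setP => v; rewrite !inE; case: eqVneq => // ->; rewrite -mem_L iL.
by rewrite S_masked // c_ge0.
Qed.

Lemma elim_supp_masked i B : B \in elim_supp i -> mask_on (elim_scope i) B = B.
Proof. by case/imsetP => A _ ->; rewrite mask_on_sub. Qed.

Lemma keyed_value_elim_notin i A : x \notin X i -> cv' i A = cv i A.
Proof.
move=> xX; have iL : i \in L = false by rewrite mem_L (negbTE xX).
have eX : elim_scope i = X i.
  by apply/setP => v; rewrite !inE; case: eqVneq => // ->; rewrite (negbTE xX).
have eS : elim_supp i = S i.
  apply/setP => B; apply/imsetP/idP => [[A' AS ->]|BS].
    by rewrite eX S_masked.
  by exists B => //; rewrite eX S_masked.
by rewrite /keyed_value eS eX /elim_value iL.
Qed.

(** The scopes in [s] lie inside [X i] and [x] is summed out, so only the coordinates in [X i :\ x]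
    matter. *)
Lemma marginal_mask s i A : {in s, forall j, X j \subset X i} ->
  marginal s (mask_on (elim_scope i) A) = marginal s A.
Proof.
move=> sXi; apply: eq_bigr => d _; rewrite !big_seq; apply: eq_bigr => j js.
by rewrite /keyed_value /elim_scope mask_on_update_mask ?sXi.
Qed.

Lemma marginal_rcons s i A :
  marginal (rcons s i) A =
  \sum_d (\prod_(j <- s) cv j (update A x d)) * cv i (update A x d).
Proof. by apply: eq_bigr => d _; rewrite -cats1 big_cat big_seq1. Qed.

(** A vanishing sum of nonnegative terms vanishes termwise, so a further factor cannot revive it. *)
Lemma marginal_rcons0 s i A : marginal s A = 0 -> marginal (rcons s i) A = 0.
Proof.
move=> /eqP; rewrite psumr_eq0; last first.
  by move=> d _; apply: prodr_ge0 => j _; apply: keyed_value_ge0.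
move=> /allP z; rewrite marginal_rcons big1 // => d _.
by have /eqP -> := z d (mem_index_enum d); rewrite mul0r.
Qed.

Lemma chain_L_rcons pre i post : L = pre ++ i :: post ->
  {in rcons pre i, forall j, X j \subset X i}.
Proof.
move=> eL j; rewrite mem_rcons inE => /predU1P [-> //|].
exact: chain_L eL j.
Qed.

(** Support elements project into [elim_supp i], so over a point outside it every extension takes
    the default. *)
Lemma keyed_value_update_default i A d :
  x \in X i -> mask_on (elim_scope i) A \notin elim_supp i ->
  cv i (update A x d) = dl i.
Proof.
move=> xX nS; rewrite /keyed_value ifN //; apply: contra nS => AS.
apply/imsetP; exists (mask_on (X i) (update A x d)) => //.
by rewrite mask_on_sub ?subD1set // /elim_scope mask_on_updateD1.
Qed.

(** On [elim_supp i] this is the defining quotient, zero denominators being covered by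
    [marginal_rcons0]; off it the factor of [i] is constantly [dl i] and leaves the sum. *)
Lemma marginal_step pre i post A : L = pre ++ i :: post ->
  marginal (rcons pre i) A = marginal pre A * cv' i A.
Proof.
move=> eL; have iL : i \in L by rewrite eL mem_cat mem_head orbT.
have sX := chain_L_rcons eL.
have sX' : {in pre, forall j, X j \subset X i}.
  by move=> j jp; apply: sX; rewrite mem_rcons inE jp orbT.
rewrite [cv' i A]/keyed_value; case: ifPn => inS.
  rewrite /elim_value iL (before_split eL) !(marginal_mask _ (i := i)) //.
  have [z|nz] := eqVneq (marginal pre A) 0.
    by rewrite z mul0r marginal_rcons0.
  by rewrite mulrC divfK.
rewrite marginal_rcons /marginal big_distrl /=; apply: eq_bigr => d _.
by rewrite keyed_value_update_default // -mem_L.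
Qed.

(** Telescoping from the empty prefix, whose marginal is [#|D|]. Denominators thus come from new
    values of earlier constraints, with no sum over [D]. *)
Lemma marginal_prefix pre post A : L = pre ++ post ->
  marginal pre A = #|D|%:R * \prod_(j <- pre) cv' j A.
Proof.
elim/last_ind: pre post => [|pre i IH] post eL.
  rewrite big_nil mulr1 /marginal.
  by under eq_bigr do rewrite big_nil; rewrite sumr_const.
rewrite cat_rcons in eL.
by rewrite (marginal_step A eL) (IH _ eL) -cats1 big_cat big_seq1 mulrA.
Qed.

(** The value of [i] is [dl i] plus a correction that vanishes off the support, so the sum over [D]
    shrinks to the support elements projecting to [B]. *)
Lemma marginal_fiber pre i post B : L = pre ++ i :: post -> B \in elim_supp i ->
  marginal (rcons pre i) B =
  dl i * marginal pre B +
  \sum_(A <- enum [set A in S i | mask_on (elim_scope i) A == B])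
    (c i A - dl i) * \prod_(j <- pre) cv j A.
Proof.
move=> eL BS; have xX : x \in X i by rewrite -mem_L eL mem_cat mem_head orbT.
have mB := elim_supp_masked BS.
have mU d : mask_on (X i) (update B x d) = update B x d.
  by rewrite update_mask_on // -/(elim_scope i) mB.
rewrite marginal_rcons /marginal big_distrr /=; apply/eqP.
rewrite -subr_eq0 opprD addrA -sumrB subr_eq0; apply/eqP.
rewrite (bigID (fun d => update B x d \in S i)) /= [X in _ + X]big1 ?addr0; last first.
  by move=> d nS; rewrite [cv i (update B x d)]/keyed_value mU (negbTE nS) mulrC subrr.
rewrite big_enum /=.
(* The fiber over [B] is parametrized by [d |-> update B x d], with inverse [A |-> A x]. *)
rewrite (reindex_onto (fun d => update B x d) (fun A : T => A x)) /=; last first.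
  move=> A; rewrite inE => /andP [AS /eqP <-].
  by rewrite update_mask_on_id // S_masked.
apply: eq_big => [d|d dS]; last first.
  by rewrite [cv i (update B x d)]/keyed_value mU dS mulrBl mulrC.
rewrite !inE {3}/update ffunE !eqxx andbT /elim_scope mask_on_updateD1.
by rewrite -/(elim_scope i) mB eqxx andbT.
Qed.

Lemma elim_value_formula pre i post B : L = pre ++ i :: post -> B \in elim_supp i ->
  elim_value i B =
  (dl i * (#|D|%:R * \prod_(j <- pre) cv' j B) +
   \sum_(A <- enum [set A in S i | mask_on (elim_scope i) A == B])
     (c i A - dl i) * \prod_(j <- pre) cv j A)
  / (#|D|%:R * \prod_(j <- pre) cv' j B).
Proof.
move=> eL BS; have iL : i \in L by rewrite eL mem_cat mem_head orbT.
by rewrite /elim_value iL (before_split eL) (marginal_fiber eL BS)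
           -(marginal_prefix B eL).
Qed.

Lemma sum_elim : \sum_A \prod_i cv i A = \sum_A \prod_i cv' i A.
Proof.
have D0 : (#|D|%:R : R) != 0.
  by rewrite pnatr_eq0 -lt0n; apply/card_gt0P; exists d0.
have prod_split (f : I -> R) :
    \prod_i f i = \prod_(i <- L) f i * \prod_(i | x \notin X i) f i.
  rewrite (bigID (fun i => x \in X i)) /=; congr (_ * _).
  rewrite big_uniq //=; apply: eq_bigl => i; exact/esym/mem_L.
(* Multiplying by [#|D|] lets [sum_update] introduce an inner sum over the value of [x]; for fixed
   [A] that sum is the marginal of [L] times the factors free of [x]. *)
apply: (mulfI D0); rewrite -(sum_update x) [RHS]big_distrr /=; apply: eq_bigr => A _.
rewrite [in RHS]prod_split mulrA -(@marginal_prefix L [::]) ?cats0 //.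
rewrite big_distrl /=; apply: eq_bigr => d _; rewrite prod_split; congr (_ * _).
apply: eq_bigr => i xX; rewrite keyed_value_elim_notin //.
by rewrite /keyed_value mask_on_update.
Qed.

End Elimination.

(** * Straight-line programs and formula cost *)

Section Programs.
Variables (D V : finType) (m : nat) (sc : 'I_m -> {set V}).
Variable supp : forall i : 'I_m, {set asg D (sc i)}.

(** Bundles the admissible weights: a quantity to compute is a function on [weights], and one
    program must serve them all. *)
Record weights := Weights {
  wval : forall i, asg D (sc i) -> rat;
  wdef : 'I_m -> rat;
  wval_ge0 : forall i a, a \in supp i -> 0 <= wval a;
  wdef_ge0 : forall i, 0 <= wdef i }.

Implicit Types (P Q : seq (instr D sc)) (g h : weights -> rat) (e : weights).

Definition run e P := exec (wval e) (wdef e) P.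

Lemma run_rcons e P ins :
  run e (rcons P ins) = rcons (run e P) (eval_instr (wval e) (wdef e) (run e P) ins).
Proof. by rewrite /run /exec foldl_rcons. Qed.

Lemma size_run e P : size (run e P) = size P.
Proof. by elim/last_ind: P => // P ins IH; rewrite run_rcons !size_rcons IH. Qed.

(** The index is chosen before the weights; its bound keeps it valid when the program is
    extended. *)
Definition avail P g := exists2 j, (j < size P)%N & forall e, nth 0 (run e P) j = g e.

Lemma avail_cat P Q g : avail P g -> avail (P ++ Q) g.
Proof.
elim/last_ind: Q => [|Q ins IH]; first by rewrite cats0.
move=> /IH [j jP jg]; exists j; rewrite -rcons_cat ?size_rcons 1?ltnW //.
by move=> e; rewrite run_rcons nth_rcons size_run jP.
Qed.

Lemma avail_rcons P ins g :
  (forall e, eval_instr (wval e) (wdef e) (run e P) ins = g e) -> avail (rcons P ins) g.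
Proof.
move=> hg; exists (size P); rewrite ?size_rcons //.
by move=> e; rewrite run_rcons nth_rcons size_run ltnn eqxx.
Qed.

Inductive arith := OAdd | OSub | OMul | ODiv.

Definition arith_op o : rat -> rat -> rat :=
  match o with
  | OAdd => fun a b => a + b
  | OSub => fun a b => a - b
  | OMul => fun a b => a * b
  | ODiv => fun a b => a / b
  end.

Definition arith_instr o : nat -> nat -> instr D sc :=
  match o with
  | OAdd => @IAdd D V m sc | OSub => @ISub D V m sc
  | OMul => @IMul D V m sc | ODiv => @IDiv D V m sc
  end.

(* [fcost A n g]: some formula of at most [n] loads and operations computes [g]
   from the functions in [A]. *)
Inductive fcost (A : (weights -> rat) -> Prop) : nat -> (weights -> rat) -> Prop :=
| FAvail n g : A g -> fcost A n g
| FLoad n g ins : (forall e vals, eval_instr (wval e) (wdef e) vals ins = g e) ->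
    (0 < n)%N -> fcost A n g
| FOp o n1 n2 n g h : fcost A n1 g -> fcost A n2 h -> (n1 + n2 < n)%N ->
    fcost A n (fun e => arith_op o (g e) (h e))
| FExt n g h : fcost A n g -> g =1 h -> fcost A n h.

Lemma fcost_leq A n n' g : (n <= n')%N -> fcost A n g -> fcost A n' g.
Proof.
move=> le_n cg; elim: cg n' le_n => {n g}.
- by move=> n g Ag n' _; apply: FAvail.
- by move=> n g ins hg n0 n' le_n; apply: FLoad hg _; apply: leq_trans le_n.
- move=> o n1 n2 n g h cg _ ch _ lt_n n' le_n.
  by apply: FOp cg ch _; apply: leq_trans le_n.
- by move=> n g h _ IH gh n' /IH cg; apply: FExt cg gh.
Qed.

Lemma fcost_sub (A A' : (weights -> rat) -> Prop) n g :
  (forall h, A h -> A' h) -> fcost A n g -> fcost A' n g.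
Proof.
move=> sA; elim=> {n g}.
- by move=> n g /sA; apply: FAvail.
- by move=> n g ins; apply: FLoad.
- by move=> o n1 n2 n g h _ cg _ ch; apply: FOp cg ch.
- by move=> n g h _ cg; apply: FExt cg.
Qed.

Lemma fcost_const A q : fcost A 1 (fun=> q).
Proof. by apply: (FLoad _ (ins := @IConst D V m sc q)). Qed.

Lemma fcost_default A i : fcost A 1 (fun e => wdef e i).
Proof. by apply: (FLoad _ (ins := @IDefault D V m sc i)). Qed.

Lemma fcost_weight A i (a : asg D (sc i)) : fcost A 1 (fun e => wval e a).
Proof. by apply: (FLoad _ (ins := @IWeight D V m sc i a)). Qed.

Lemma fcost_prod A (K : eqType) (s : seq K) k n (f : K -> weights -> rat) g :
  {in s, forall t, fcost A k (f t)} -> fcost A n g ->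
  fcost A (n + size s * k.+1) (fun e => g e * \prod_(t <- s) f t e).
Proof.
elim: s n g => [|t s IH] n g cf cg.
  by rewrite addn0; apply: FExt cg _ => e; rewrite big_nil mulr1.
have cgt : fcost A (n + k.+1) (fun e => g e * f t e).
  by apply: (FOp OMul cg (cf t _)); rewrite ?mem_head ?addnS.
rewrite /= mulSn addnA; apply: FExt (IH _ _ _ cgt) _ => [u us|e].
  by apply: cf; rewrite inE us orbT.
by rewrite big_cons mulrA.
Qed.

Lemma fcost_sum A (K : eqType) (s : seq K) k n (f : K -> weights -> rat) g :
  {in s, forall t, fcost A k (f t)} -> fcost A n g ->
  fcost A (n + size s * k.+1) (fun e => g e + \sum_(t <- s) f t e).
Proof.
elim: s n g => [|t s IH] n g cf cg.
  by rewrite addn0; apply: FExt cg _ => e; rewrite big_nil addr0.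
have cgt : fcost A (n + k.+1) (fun e => g e + f t e).
  by apply: (FOp OAdd cg (cf t _)); rewrite ?mem_head ?addnS.
rewrite /= mulSn addnA; apply: FExt (IH _ _ _ cgt) _ => [u us|e].
  by apply: cf; rewrite inE us orbT.
by rewrite big_cons addrA.
Qed.

Lemma fcost_compile P n g : fcost (avail P) n g ->
  exists Q, (size Q <= n)%N /\ avail (P ++ Q) g.
Proof.
(* Generalized over [P'] because the second operand of an operation is compiled after the code of
   the first. *)
move=> cg; suff: forall P', (forall h, avail P h -> avail P' h) ->
  exists Q, (size Q <= n)%N /\ avail (P' ++ Q) g by apply.
elim: cg => {n g}.
- by move=> n g Pg P' sP; exists [::]; rewrite cats0; split => //; apply: sP.
- move=> n g ins hg n0 P' _; exists [:: ins]; split=> //.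
  by rewrite cats1; apply: avail_rcons.
- move=> o n1 n2 n g h _ IHg _ IHh lt_n P' sP.
  have [Q1 [sQ1 ag]] := IHg _ sP.
  have [Q2 [sQ2 [k kQ kh]]] := IHh (P' ++ Q1) (fun f Pf => avail_cat Q1 (sP f Pf)).
  have [j jQ jg] := avail_cat Q2 ag.
  exists (rcons (Q1 ++ Q2) (arith_instr o j k)); split.
    by rewrite size_rcons size_cat; lia.
  rewrite -rcons_cat catA; apply: avail_rcons => e.
  by case: o => /=; rewrite jg kh.
- move=> n g h _ IH gh P' /IH [Q [sQ [j jQ jg]]]; exists Q; split=> //.
  by exists j => // e; rewrite jg gh.
Qed.

Lemma fcost_compile_seq (K : eqType) (s : seq K) n (f : K -> weights -> rat) P :
  {in s, forall t, fcost (avail P) (n t) (f t)} ->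
  exists Q, (size Q <= \sum_(t <- s) n t)%N /\ {in s, forall t, avail (P ++ Q) (f t)}.
Proof.
elim: s P => [|t s IH] P cf; first by exists [::]; rewrite big_nil.
have [Q1 [sQ1 a1]] := fcost_compile (cf t (mem_head _ _)).
have [|Q2 [sQ2 a2]] := IH (P ++ Q1).
  move=> u us; apply: fcost_sub (cf u _); first by move=> h; apply: avail_cat.
  by rewrite inE us orbT.
exists (Q1 ++ Q2); rewrite big_cons size_cat; split; first exact: leq_add.
by move=> u; rewrite inE catA => /predU1P [->|/a2 //]; apply: avail_cat.
Qed.

(** The output is the last value, whereas [g] may be stored earlier; adding a loaded 0 brings it to
    the end at a cost of 2. *)
Lemma fcost_output P n g : fcost (avail P) n g ->
  exists Q, (size Q <= n + 2)%N /\
    forall e, output (wval e) (wdef e) (P ++ Q) = g e.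
Proof.
move=> /fcost_compile [Q [sQ aQ]].
have [Q1 [sQ1 [k kQ k1]]] := fcost_compile (fcost_const (avail (P ++ Q)) 0).
have [j jQ jg] := avail_cat Q1 aQ.
exists (rcons (Q ++ Q1) (@IAdd D V m sc j k)); split.
  by rewrite size_rcons size_cat; lia.
move=> e; rewrite -rcons_cat catA /output -/(run e _) run_rcons last_rcons /=.
by rewrite jg k1 addr0.
Qed.

(** * Compiling the elimination *)

Section EliminationProgram.
Variable d0 : D.
Notation T := {ffun V -> D}.
Implicit Types (X : 'I_m -> {set V}) (S : 'I_m -> {set T})
  (c : 'I_m -> T -> weights -> rat).

Definition value_at X S c e := keyed_value d0 X S (fun i B => c i B e) (wdef e).

Definition total_weight X S c e : rat := \sum_A \prod_(i < m) value_at X S c e i A.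

(** The invariant between eliminations. Only support values are stored; defaults never change and
    are loaded on demand. *)
Record elim_state X S c P : Prop := ElimState {
  st_avail : forall i B, B \in S i -> avail P (c i B);
  st_masked : forall i B, B \in S i -> mask_on d0 (X i) B = B;
  st_ge0 : forall i B e, B \in S i -> 0 <= c i B e }.

Lemma fcost_value_at X S c P i A : (forall B, B \in S i -> avail P (c i B)) ->
  fcost (avail P) 1 (fun e => value_at X S c e i A).
Proof.
move=> aS; rewrite /value_at /keyed_value.
case AS: (mask_on d0 (X i) A \in S i); last exact: fcost_default.
by apply: FAvail; apply: aS.
Qed.

(** [N] bounds nonempty scopes only: an empty scope may keep a support element that the norm does
    not count, but it takes part in no elimination. *)
Lemma elim_state_step X S c P x N :
  elim_state X S c P ->
  (forall i j, x \in X i -> x \in X j -> X i \subset X j \/ X j \subset X i) ->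
  (\sum_(i < m | X i != set0) #|S i| <= N)%N ->
  exists S' c' Q,
    [/\ elim_state (fun i => X i :\ x) S' c' (P ++ Q),
        (size Q <= 16 * #|[set i | x \in X i]| * N)%N,
        (\sum_(i < m | X i :\ x != set0) #|S' i| <= N)%N
      & forall e, total_weight X S c e = total_weight (fun i => X i :\ x) S' c' e].
Proof.
move=> [aS mS S0] nested leN.
pose le_card : rel 'I_m := fun i j => (#|X i| <= #|X j|)%N.
(* Nested scopes sorted by cardinality are sorted by inclusion, a tie forcing equality. *)
pose L := sort le_card (enum [set i | x \in X i]).
have mem_L i : (i \in L) = (x \in X i) by rewrite mem_sort mem_enum inE.
have uniq_L : uniq L by rewrite sort_uniq enum_uniq.
have size_L : size L = #|[set i | x \in X i]| by rewrite size_sort -cardE.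
have chain_L pre i post : L = pre ++ i :: post ->
    forall j, j \in pre -> X j \subset X i.
  move=> eL j jpre.
  have xi : x \in X i by rewrite -mem_L eL mem_cat mem_head orbT.
  have xj : x \in X j by rewrite -mem_L eL mem_cat jpre.
  have: sorted le_card L by apply: sort_sorted => a b; apply: leq_total.
  rewrite sorted_pairwise; last by move=> b a d; apply: leq_trans.
  rewrite eL pairwise_cat => /and3P [/allrelP /(_ j i jpre (mem_head _ _)) leji _ _].
  case: (nested j i xj xi) => // sij; suff -> : X i = X j by [].
  by apply/eqP; rewrite eqEcard sij.
pose X' := elim_scope X x; pose S' := elim_supp d0 X S x.
pose c' i B e := elim_value d0 X S (fun i B => c i B e) (wdef e) x L i B.
have cge0 e i B : B \in S i -> 0 <= c i B e by apply: S0.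
have aS' i B : x \notin X i -> B \in S' i -> avail P (c' i B).
  move=> xX BS'; have iL : i \in L = false by rewrite mem_L (negbTE xX).
  have BS : B \in S i.
    case/imsetP: BS' => A AS ->; rewrite /elim_scope.
    have -> : X i :\ x = X i.
      by apply/setP => v; rewrite !inE; case: eqVneq => // ->; rewrite (negbTE xX).
    by rewrite mS.
  have [j jP jc] := aS i B BS; exists j => // e.
  by rewrite jc /c' /elim_value iL.
(* The chain is processed in order, since the formula for [i] uses the new values of all earlier
   constraints. *)
have chain pre post : L = pre ++ post ->
    exists Q, (size Q <= \sum_(i <- pre) #|S i| * (16 * size L))%N /\
      forall i B, i \in pre -> B \in S' i -> avail (P ++ Q) (c' i B).
  elim/last_ind: pre post => [|pre i IH] post eL.
    by exists [::]; rewrite big_nil; split.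
  rewrite cat_rcons in eL; have [Q [sQ aQ]] := IH _ eL.
  have lt_pre : (size pre < size L)%N by rewrite eL size_cat /= addnS ltnS leq_addr.
  pose fiber B := [set A in S i | mask_on d0 (X' i) A == B].
  pose k := size pre.
  (* Numerator and denominator each contain the product over [pre], about [2 * k] operations; every
     fiber element adds a product of [k] old values. *)
  pose cost B := ((4 * k + 6) + #|fiber B| * (2 * k + 6))%N.
  have [B|Q' [sQ' aQ']] := @fcost_compile_seq _ (enum (S' i)) cost (c' i) (P ++ Q).
    rewrite mem_enum => BS'.
    have cP : fcost (avail (P ++ Q)) (1 + k * 2)
        (fun e => #|D|%:R * \prod_(j <- pre) value_at X' S' c' e j B).
      apply: fcost_prod (fcost_const _ _) => j jpre.
      by apply: fcost_value_at => C CS; apply: aQ.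
    (* The leading 1 is the initial factor that [fcost_prod] starts from. *)
    have cQ A : fcost (avail (P ++ Q)) (1 + k * 2)
        (fun e => 1 * \prod_(j <- pre) value_at X S c e j A).
      apply: fcost_prod (fcost_const _ _) => j jpre.
      by apply: fcost_value_at => C CS; apply: avail_cat; apply: aS.
    have cD := fcost_default (avail (P ++ Q)) i.
    have cDP := FOp OMul cD cP (ltnSn _).
    have cF : {in enum (fiber B), forall A, fcost (avail (P ++ Q)) (2 * k + 5)
        (fun e => (c i A e - wdef e i) *
                  (1 * \prod_(j <- pre) value_at X S c e j A))}.
      move=> A; rewrite mem_enum inE => /andP [AS _].
      have cA := FAvail 0 (avail_cat Q (aS i A AS)).
      have cAD := FOp OSub cA cD (ltnSn _).
      by apply: (FOp OMul cAD (cQ A)); lia.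
    have cN := fcost_sum cF cDP.
    have cR := FOp ODiv cN cP (ltnSn _).
    apply: FExt (fcost_leq _ cR) _; first by rewrite /cost -cardE; lia.
    move=> e; rewrite /= /c' (elim_value_formula mem_L uniq_L chain_L mS (cge0 e)
      (wdef_ge0 e) eL BS') /arith_op.
    by congr ((_ + _) / _); rewrite /fiber /X'; apply: eq_bigr => A _; rewrite mul1r.
  exists (Q ++ Q'); split.
    rewrite -cats1 big_cat big_seq1 size_cat leq_add //; apply: leq_trans sQ' _.
    rewrite big_enum /= big_split /= -big_distrl /= sum_nat_const.
    (* The fibers partition [S i], so each support element is charged once. *)
    have -> : (\sum_(B in S' i) #|fiber B| = #|S i|)%N.
      rewrite -[RHS]sum1_card [RHS](partition_big_imset (mask_on d0 (X' i))) /=.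
      by apply: eq_bigr => B _; rewrite -sum1_card; apply: eq_bigl => A; rewrite inE.
    have leS : (#|S' i| <= #|S i|)%N by apply: leq_imset_card.
    apply: (@leq_trans (#|S i| * (4 * k + 6) + #|S i| * (2 * k + 6))).
      by rewrite leq_add2r leq_mul2r leS orbT.
    (* Since [k < size L], [6 * k + 12 <= 12 * size L]. *)
    by rewrite -mulnDr leq_mul2l; apply/orP; right; rewrite /k; lia.
  move=> j B; rewrite mem_rcons inE catA => /predU1P [->|jpre] BS'.
    by apply: aQ'; rewrite mem_enum.
  by apply: avail_cat; apply: aQ.
have [|Q [sQ aQ]] := chain L [::]; first by rewrite cats0.
exists S', c', Q; split.
- split=> [i B BS'|i B|i B e].
  + have [xX|xX] := boolP (x \in X i); first by apply: aQ; rewrite ?mem_L.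
    by apply: avail_cat; apply: aS'.
  + exact: elim_supp_masked.
  + exact: (elim_value_ge0 mem_L mS (cge0 e) (wdef_ge0 e)).
- apply: leq_trans sQ _; rewrite -big_distrl /= size_L mulnC leq_mul2l.
  apply/orP; right; apply: leq_trans leN.
  rewrite big_uniq //= [leqRHS](bigID (fun i => x \in X i)) /=.
  apply: leq_trans (leq_addr _ _); apply: eq_leq; apply: eq_bigl => i.
  rewrite mem_L; case: (boolP (x \in X i)) => xX; rewrite ?andbF // andbT.
  by apply/esym/set0Pn; exists x.
- apply: leq_trans leN; rewrite [leqRHS](bigID (fun i => X i :\ x != set0)) /=.
  apply: leq_trans (leq_addr _ _).
  rewrite [leqRHS](eq_bigl (fun i => X i :\ x != set0)) => [|i].
    by apply: leq_sum => i _; apply: leq_imset_card.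
  case: (boolP (X i :\ x != set0)) => [/set0Pn [v]|]; rewrite ?andbF // andbT.
  by rewrite !inE => /andP [_ vX]; apply/set0Pn; exists v.
- move=> e; rewrite /total_weight /value_at.
  exact: (sum_elim mem_L uniq_L chain_L mS (cge0 e) (wdef_ge0 e)).
Qed.

(** Only nonempty scopes must be edges, as [hremove] discards the empty edge. By double counting,
    the numbers of scopes met by the eliminated vertices add up to the total scope size. *)
Lemma beta_elim_program H s X S c P N :
  beta_elim H s ->
  (forall i, X i \subset hV H) -> (forall i, X i != set0 -> X i \in hE H) ->
  elim_state X S c P ->
  (\sum_(i < m | X i != set0) #|S i| <= N)%N ->
  exists S' c' Q,
    [/\ elim_state (fun=> set0) S' c' (P ++ Q),
        (size Q <= 16 * (\sum_(i < m) #|X i|) * N)%N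
      & forall e, total_weight X S c e = total_weight (fun=> set0) S' c' e].
Proof.
move=> bH; elim: bH X S c P => {H s}.
- move=> H H0 X S c P sX _ [aS mS S0] _; exists S, c, [::].
  have X0 i : X i = set0 by apply/eqP; rewrite -subset0 -H0 sX.
  rewrite cats0; split=> //.
    by split=> // i B BS; rewrite -[RHS](mS i) // X0.
  move=> e; apply: eq_bigr => A _; apply: eq_bigr => i _.
  by rewrite /value_at /keyed_value X0.
- move=> H x s [xH nest] _ IH X S c P sX eX st leN.
  have [|S1 [c1 [Q1 [st1 sQ1 leN1 w1]]]] := elim_state_step (x := x) st _ leN.
    by move=> i j xi xj; apply: nest => //; apply: eX; apply/set0Pn; exists x.
  have [i|i Xi|S2 [c2 [Q2 [st2 sQ2 w2]]]] := IH _ _ _ _ _ _ st1 leN1.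
  + exact: setSD.
  + rewrite in_setD1 Xi /=; apply/imset_f/eX.
    by case/set0Pn: Xi => v; rewrite !inE => /andP [_ vX]; apply/set0Pn; exists v.
  exists S2, c2, (Q1 ++ Q2); rewrite catA; split=> //; last by move=> e; rewrite w1.
  rewrite size_cat; apply: leq_trans (leq_add sQ1 sQ2) _.
  rewrite -mulnDl -mulnDr leq_mul2r leq_mul2l /=; apply/orP; right.
  rewrite -sum1_card big_mkcond -big_split /=; apply: leq_sum => i _.
  by rewrite [leqRHS](cardsD1 x) inE; case: (x \in X i).
Qed.

Lemma total_weight_const S c e :
  total_weight (fun=> set0) S c e =
  #|{: T}|%:R * \prod_(i < m) value_at (fun=> set0) S c e i [ffun=> d0].
Proof.
rewrite /total_weight mulr_natl -sumr_const; apply: eq_bigr => A _.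
apply: eq_bigr => i _; rewrite /value_at /keyed_value.
suff -> : mask_on d0 set0 A = mask_on d0 set0 [ffun=> d0] by [].
by apply/ffunP => v; rewrite !ffunE inE.
Qed.

End EliminationProgram.
End Programs.

(** * Restricted versus total assignments *)

Section Extension.
Variables (D V : finType) (d0 : D).
Implicit Types (X Y : {set V}) (A : {ffun V -> D}).

Definition extend X (a : asg D X) : {ffun V -> D} :=
  [ffun v => if insub v is Some u then a u else d0].

Definition project X A : asg D X := [ffun u => A (val u)].

Lemma extendK X : cancel (@extend X) (project X).
Proof. by move=> a; apply/ffunP => u; rewrite !ffunE valK. Qed.

Lemma projectK X A : extend (project X A) = mask_on d0 X A.
Proof.
apply/ffunP => v; rewrite !ffunE.
by case: (insubP {u : V | u \in X} v) => [u -> <-|/negbTE ->] //; rewrite ffunE.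
Qed.

Lemma restr_project X Y (h : X \subset Y) A : restr h (project Y A) = project X A.
Proof. by apply/ffunP => u; rewrite !ffunE. Qed.

(** The number [#|D| ^ (#|V| - #|X|)] of total extensions of an assignment on [X], as a product
    matching [card_family]. *)
Definition fiber_size X : nat := \prod_(v : V) #|if v \in X then pred1 d0 else predT|.

Lemma card_project_fiber X (a : asg D X) :
  #|[pred A | project X A == a]| = fiber_size X.
Proof.
pose F v : pred D := if insub v is Some u then pred1 (a u) else predT.
have cF v : #|if v \in X then pred1 d0 else predT| = #|F v|.
  by rewrite /F; case: (insubP {u : V | u \in X} v) => [u -> _|/negbTE ->];
     rewrite ?card1.
transitivity #|family F|; last first.
  rewrite card_family foldrE big_image; apply: eq_bigr => v _.
  by rewrite cF.
apply: eq_card => A; rewrite !inE.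
apply/eqP/familyP => [pA v|h].
  by rewrite /F -pA; case: (insubP {u : V | u \in X} v) => // u _ uv; rewrite !inE ffunE uv.
apply/ffunP => u; rewrite ffunE; have := h (val u).
by rewrite /F valK inE => /eqP.
Qed.

Lemma fiber_size_gt0 X : (0 < fiber_size X)%N.
Proof.
apply: prodn_gt0 => v; apply/card_gt0P; exists d0.
by case: ifP; rewrite inE.
Qed.

Lemma sum_project (R : pzRingType) X (F : asg D X -> R) :
  \sum_A F (project X A) = (fiber_size X)%:R * \sum_a F a.
Proof.
rewrite (partition_big (project X) predT) //= big_distrr /=.
apply: eq_bigr => a _; rewrite (eq_bigr (fun=> F a)) => [|A /eqP -> //].
by rewrite sumr_const card_project_fiber mulr_natl.
Qed.

End Extension.

(** * Assembling the program of an instance *)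

Section Instance.
Variables (D V : finType) (m : nat) (sc : 'I_m -> {set V}).
Variable supp : forall i : 'I_m, {set asg D (sc i)}.

Lemma card_asg0 (X : {set V}) : X = set0 -> #|{: asg D X}| = 1%N.
Proof.
move=> X0; rewrite card_ffun card_sig [X in (_ ^ X)%N]eq_card0 ?expn0 // => v.
by rewrite inE X0 in_set0.
Qed.

(** The extra 1 pays for the empty assignment of an empty scope, which the norm does not count. *)
Lemma card_supp_le i : (#|supp i| <= #|supp i| * #|sc i| + 1)%N.
Proof.
have [X0|/set0Pn [v vX]] := eqVneq (sc i) set0.
  by apply: leq_trans (leq_addl _ _); rewrite -(card_asg0 X0) max_card.
have : (0 < #|sc i|)%N by apply/card_gt0P; exists v.
by nia.
Qed.

Section Inhabited.
Variable d0 : D.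

Definition init_supp i := @extend D V d0 (sc i) @: supp i.
Definition init_value i (B : {ffun V -> D}) (e : weights supp) :=
  wval e (project (sc i) B).

Lemma value_at_init (e : weights supp) i A :
  value_at d0 sc init_supp init_value e i A =
  cval (supp i) (@wval _ _ _ _ _ e i) (wdef e i) (project (sc i) A).
Proof.
rewrite /value_at /keyed_value /cval -projectK mem_imset; last first.
  exact: can_inj (@extendK _ _ _ _).
by rewrite /init_value extendK.
Qed.

(** Total assignments also range over variables outside [varI sc], so each assignment of the
    instance is counted [fiber_size] times. *)
Lemma total_weight_init (e : weights supp) :
  total_weight d0 sc init_supp init_value e =
  (fiber_size d0 (varI sc))%:R * wI supp (wval e) (wdef e).
Proof.
rewrite /wI -(sum_project d0); apply: eq_bigr => A _; apply: eq_bigr => i _.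
by rewrite value_at_init restr_project.
Qed.

(** Load the support values, eliminate, multiply the [m] remaining constants: at most
    [normI supp + m], [16 * sI sc * normI supp] and [2 * m + 3] operations. *)
Lemma program_inhabited : beta_acyclic (HI sc) ->
  exists P : seq (instr D sc),
    (size P <= 18 * ((sI sc) ^ 2 * normI supp + m + 1))%N /\
    forall e : weights supp, output (wval e) (wdef e) P = wI supp (wval e) (wdef e).
Proof.
case=> s bs.
pose keys := [seq (i, B) | i <- enum 'I_m, B <- enum (init_supp i)].
have [|P0 [sP0 aP0]] := @fcost_compile_seq D V m sc supp _ keys (fun=> 1%N)
    (fun p => init_value p.1 p.2) [::].
  by move=> p _; apply: fcost_weight.
have leS i : (#|init_supp i| <= #|supp i|)%N by apply: leq_imset_card.
have leP0 : (size P0 <= normI supp + m)%N.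
  apply: leq_trans sP0 _; rewrite big_allpairs_dep big_enum /=.
  have -> : (normI supp + m = normI supp + \sum_(i < m) 1)%N by rewrite sum1_card card_ord.
  rewrite -big_split /=; apply: leq_sum => i _.
  by rewrite sum1_size -cardE; apply: leq_trans (leS i) (card_supp_le i).
have st : elim_state d0 sc init_supp init_value P0.
  split=> [i B BS|i B /imsetP [a _ ->]|i B e /imsetP [a aS ->]].
  - by apply: (aP0 (i, B)); apply/allpairsPdep; exists i, B; rewrite !mem_enum.
  - by rewrite -projectK extendK.
  - by rewrite /init_value extendK wval_ge0.
have leN : (\sum_(i < m | sc i != set0) #|init_supp i| <= normI supp)%N.
  rewrite /normI big_mkcond /=; apply: leq_sum => i _; case: ifP => // sc0.
  apply: leq_trans (leS i) _; rewrite -[leqLHS]muln1 leq_mul2l.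
  by rewrite card_gt0 sc0 orbT.
have [||S' [c' [Q [[aS _ _] sQ wQ]]]] := beta_elim_program bs _ _ st leN.
- by move=> i; apply: sc_sub_var.
- by move=> i _; apply: imset_f.
(* The count of total assignments left once all scopes are empty, divided by the multiplicity from
   [total_weight_init]. *)
pose ratio : rat := #|{: {ffun V -> D}}|%:R / (fiber_size d0 (varI sc))%:R.
pose val i (e : weights supp) := value_at d0 (fun=> set0) S' c' e i [ffun=> d0].
have cv : {in index_enum 'I_m, forall i, fcost (avail (P0 ++ Q)) 1 (val i)}.
  by move=> i _; apply: fcost_value_at => B; apply: aS.
have [Q' [sQ' oQ']] := fcost_output (fcost_prod cv (fcost_const _ ratio)).
exists ((P0 ++ Q) ++ Q'); split; last first.
  move=> e; rewrite oQ' /ratio mulrAC -total_weight_const -wQ total_weight_init.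
  by rewrite mulrC mulKf // pnatr_eq0 -lt0n fiber_size_gt0.
move: sQ sQ'; rewrite !size_cat -/(sI sc) -[index_enum _]enumT size_enum_ord.
have : (sI sc * normI supp <= sI sc ^ 2 * normI supp)%N.
  by rewrite leq_mul2r; apply/orP; right; case: (sI sc) => // k; nia.
have : (normI supp <= sI sc * normI supp)%N.
  (* If [sI sc] is 0, all scopes are empty and the norm is 0 too. *)
  have [s0|] := posnP (sI sc); last by nia.
  rewrite /normI big1 // => i _; apply/eqP; rewrite muln_eq0; apply/orP; right.
  by rewrite -leqn0 -s0 /sI (bigD1 i) //= leq_addr.
move: (sI sc ^ 2 * normI supp)%N => u; rewrite -mulnA.
by move: (sI sc * normI supp)%N => v; lia.
Qed.

End Inhabited.

(** Here no [d0] exists for masking. With a variable present there is no assignment and the weight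
    is 0; otherwise the single empty assignment leaves a product of [m] values. *)
Lemma program_empty_domain : #|D| = 0%N ->
  exists P : seq (instr D sc),
    (size P <= 18 * ((sI sc) ^ 2 * normI supp + m + 1))%N /\
    forall e : weights supp, output (wval e) (wdef e) P = wI supp (wval e) (wdef e).
Proof.
move=> D0; have [X0|/set0Pn [v vX]] := eqVneq (varI sc) set0; last first.
  (* The empty program outputs the default 0 of [last]. *)
  exists [::]; split=> // e; rewrite /wI big1 // => a _.
  by have := card0_eq D0 (a (Sub v vX)); rewrite inE.
have /eqP/fintype1P [a0 a0P] : #|{: asg D (varI sc)}| = 1%N by apply: card_asg0.
pose val i (e : weights supp) :=
  cval (supp i) (@wval _ _ _ _ _ e i) (wdef e i) (restr (sc_sub_var sc i) a0).
have cv : {in index_enum 'I_m, forall i, fcost (avail [::]) 1 (val i)}.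
  move=> i _; rewrite /val /cval.
  case: (restr _ a0 \in supp i); [exact: fcost_weight | exact: fcost_default].
have [Q [sQ oQ]] := fcost_output (fcost_prod cv (fcost_const _ 1)).
exists Q; split.
  apply: leq_trans sQ _; rewrite -[index_enum _]enumT size_enum_ord.
  by move: (sI sc ^ 2 * _)%N => u; lia.
move=> e; rewrite oQ mul1r /wI (big_pred1 a0) // => a; rewrite /= (a0P a) eqxx //.
Qed.

End Instance.

Theorem theorem2 :
  exists K : nat,
  forall (D V : finType) (m : nat) (sc : 'I_m -> {set V})
         (supp : forall i : 'I_m, {set asg D (sc i)}),
    beta_acyclic (HI sc) ->
    exists P : seq (instr D sc),
      (size P <= K * ((sI sc) ^ 2 * normI supp + m + 1))%N /\
      forall (fv : forall i : 'I_m, asg D (sc i) -> rat) (dv : 'I_m -> rat),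
        (forall i a, a \in supp i -> 0 <= fv i a) ->
        (forall i, 0 <= dv i) ->
        output fv dv P = wI supp fv dv.
Proof.
exists 18%N => D V m sc supp acyclic.
suff [P [sP oP]] : exists P : seq (instr D sc),
    (size P <= 18 * ((sI sc) ^ 2 * normI supp + m + 1))%N /\
    forall e : weights supp, output (wval e) (wdef e) P = wI supp (wval e) (wdef e).
  exists P; split=> // fv dv fv0 dv0; exact: (oP (Weights fv0 dv0)).
have [D0|] := posnP #|D|; first exact: program_empty_domain.
by case/card_gt0P => d0 _; apply: program_inhabited d0 acyclic.
Qed.
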